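(* Let the approximate value iteration $$\hat V^{i+1}(x)=\min_{v\in\{0,1\}}\Big(U(x,v)+\hat V^i\big(F_v(x)\big)\Big)+\epsilon^i(x),\quad\forall x,$$ be conducted using a continuous function approximator (so that each $\hat V^i$ is continuous), with the approximation error bounded by $|\epsilon^i(x)|\le c\,U(x,0)$ for all $x$ and all $i$, for some $c\in[0,1)$. Let the iteration be terminated at the $i$-th iteration when $$|\hat V^i(x)-\hat V^{i+1}(x)|\le\delta(x),\quad\forall x\in\Omega,$$ for some positive (semi-)definite real-valued function $\delta(\cdot)$. Assume that, for each $v\in\{0,1\}$, the intersection of $\{x:U(x,v)=0\}$ with the invariant set of $F_v$ contains only the origin. Then the resulting triggering policy $$\hat v^i(x)=\operatorname*{arg\,min}_{v\in\{0,1\}}\Big(U(x,v)+\hat V^i\big(F_v(x)\big)\Big)$$ asymptotically stabilizes the system, i.e. the origin is asymptotically stable for $x_{k+1}=F_{\hat v^i(x_k)}(x_k)$, if $$\delta(x)<(1-c)\,U(x,0),\quad\forall x\in\Omega-\{0\}.$$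
   Context: Setting. A plant $x_{k+1}=f(x_k,u_k)$ has $f:\mathbb{R}^n\times\mathbb{R}^m\to\mathbb{R}^n$ continuous, $f(0,0)=0$. A continuous control policy $h:\mathbb{R}^n\to\mathbb{R}^m$ is given. A triggering (scheduling) policy is a map $v(\cdot)$ from the state space to $\{0,1\}$; $v=1$ means the network is used to transmit the state to the controller, $v=0$ means it is not. The overall system is the switched system $x_{k+1}=F_{v_k}(x_k)$ with $F_0(x)=f(x,0)$ and $F_1(x)=f(x,h(x))$. (In the zero-order-hold and generalized zero-order-hold variants the state $x$ is replaced by the augmented state $y=[x^T,d^T]^T$, $d$ being the last transmitted state or its model-based update, with corresponding continuous modes $F_0,F_1$.) Cost. $J=\sum_{k=0}^\infty U(x_k,v_k)$, where $U:\mathbb{R}^n\times\{0,1\}\to\mathbb{R}^+$ ($\mathbb{R}^+$ denotes the non-negative reals) is positive semi-definite and continuous in its first argument; for example $U(x,v)=Q(x)+c_s(x)v$ with $Q,c_s$ non-negative functions, $c_s$ a positive semi-definite state-dependent scheduling weight. $\Omega$ is a compact set of states containing the origin. Admissibility of $h$. $h$ is assumed admissible in $\Omega$: $h$ is continuous with $h(0)=0$, it asymptotically stabilizes $x_{k+1}=f(x_k,h(x_k))$ within $\Omega$, and $V_h(x_0):=\sum_{k=0}^\infty U(x_k^h,0)$ is continuous in $\Omega$, where $x_0^h=x_0$, $x_k^h=f(x_{k-1}^h,h(x_{k-1}^h))$. Initialization. The initial guess $\hat V^0$ satisfies $\underline V^0(x)\le\hat V^0(x)\le\overline V^0(x)$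 for all $x$, where $\underline V^0,\overline V^0$ are the initial guesses of the exact value iterations $\underline V^{i+1}(x)=\min_{v}\big(U(x,v)-cU(x,0)+\underline V^i(F_v(x))\big)$ and $\overline V^{i+1}(x)=\min_{v}\big(U(x,v)+cU(x,0)+\overline V^i(F_v(x))\big)$. Initial guesses for value iteration are taken as non-negative functions $V^0$ bounded above by the running cost evaluated with $v=0$ (for instance $V^0=0$). Meaning of the invariant-set assumption: there is no set of states other than $\{0\}$ in which a trajectory can stay forever with zero running cost, i.e. without converging to the origin.
   Formalization: The formal theorem additionally assumes U(x,0) ≤ U(x,1) for all x (the form Q + c_s v with c_s ≥ 0) and that the origin is interior to Ω; without either, the claim as stated is false (a 2-cycle for a cost violating the first; Ω={0} makes the conditions vacuous). *)

(* Defs.v *)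
From mathcomp Require Import all_boot all_order all_algebra.
From mathcomp Require Import all_classical all_reals all_analysis.

Set Implicit Arguments.
Unset Strict Implicit.
Unset Printing Implicit Defensive.

Import Order.TTheory GRing.Theory Num.Theory.
Import numFieldNormedType.Exports.

Local Open Scope classical_set_scope.
Local Open Scope ring_scope.

(* The switching variable v ranges over bool: [true] is v = 1 (the state is
   transmitted to the controller), [false] is v = 0 (it is not).  The norm on
   row vectors is the max norm, which induces the usual topology of R^n. *)

Section Stability.
Variables (R : realType) (n : nat).
Implicit Types (G : 'rV[R]_n -> 'rV[R]_n) (Omega : set 'rV[R]_n).

Definition positive_semidefinite (g : 'rV[R]_n -> R) : Prop :=
  g 0 = 0 /\ forall x, 0 <= g x.

Definition lyapunov_stable G : Prop :=
  forall e : R, 0 < e -> exists2 d : R, 0 < d &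
    forall x0, `|x0| < d -> forall k, `|iter k G x0| < e.

Definition converges_to_origin G (x0 : 'rV[R]_n) : Prop :=
  iter k G x0 @[k --> \oo] --> (0 : 'rV[R]_n).

Definition asymptotically_stable G : Prop :=
  lyapunov_stable G /\
  exists2 r : R, 0 < r & forall x0, `|x0| < r -> converges_to_origin G x0.

Definition asymptotically_stable_within Omega G : Prop :=
  lyapunov_stable G /\ forall x0, Omega x0 -> converges_to_origin G x0.

(* The largest set contained in A from which trajectories never leave A, as in
   LaSalle's invariance principle. *)
Definition invariant_part G (A : set 'rV[R]_n) : set 'rV[R]_n :=
  \bigcup_(S in [set S | S `<=` A /\ G @` S `<=` S]) S.

End Stability.

Section Scheduling.
Variables (R : realType) (n m : nat).
Implicit Types (f : 'rV[R]_n -> 'rV[R]_m -> 'rV[R]_n)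
  (h : 'rV[R]_n -> 'rV[R]_m) (U W : 'rV[R]_n -> bool -> R)
  (F : bool -> 'rV[R]_n -> 'rV[R]_n) (V : 'rV[R]_n -> R)
  (pol : 'rV[R]_n -> bool).

Definition mode f h (v : bool) (x : 'rV[R]_n) : 'rV[R]_n :=
  f x (if v then h x else 0).

Definition running_cost U : Prop :=
  forall v, continuous (U ^~ v) /\ positive_semidefinite (U ^~ v).

(* Equivalently, the running cost has the form U(x,v) = Q(x) + c_s(x) v with
   Q and the scheduling weight c_s non-negative. *)
Definition nonneg_scheduling_weight U : Prop :=
  forall x, U x false <= U x true.

Definition cost_to_go U G (x : 'rV[R]_n) : R^nat :=
  series (fun k => U (iter k G x) false).

Definition admissible (Omega : set 'rV[R]_n) f U h : Prop :=
  [/\ continuous h,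
      h 0 = 0,
      asymptotically_stable_within Omega (mode f h true),
      forall x, Omega x -> cvgn (cost_to_go U (mode f h true) x)
    & {within Omega,
        continuous (fun x => limn (cost_to_go U (mode f h true) x))}].

Definition bellman W F V (x : 'rV[R]_n) : R :=
  Num.min (W x false + V (F false x)) (W x true + V (F true x)).

(* Exact value iteration for the running cost W.  The initial guess lies
   between 0 and the running cost evaluated at v = 0. *)
Definition exact_value_iteration W F (V : nat -> 'rV[R]_n -> R) : Prop :=
  (forall x, 0 <= V 0%N x <= W x false) /\
  forall i x, V i.+1 x = bellman W F (V i) x.

(* pol selects a minimizing mode at every state; ties are broken
   arbitrarily. *)
Definition greedy_policy W F V pol : Prop :=
  forall x v, W x (pol x) + V (F (pol x) x) <= W x v + V (F v x).

Definition closed_loop F pol (x : 'rV[R]_n) : 'rV[R]_n := F (pol x) x.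

End Scheduling.

(* Main.v *)
Require Import Defs.
From mathcomp Require Import all_boot all_order all_algebra.
From mathcomp Require Import all_classical all_reals all_analysis.
From mathcomp Require Import lra.
Import Order.TTheory GRing.Theory Num.Theory.
Import numFieldNormedType.Exports.
Local Open Scope classical_set_scope.
Local Open Scope ring_scope.

(* The approximate value function V := Vhat i is a Lyapunov function for the
   closed loop.  The greedy choice gives V (G x) <= V x - D x with
   D x := V x - bellman U V x + U x false; unlike the tolerance delta, D is
   continuous, and the error bound and the termination test give
   D x >= (1 - c) U x false - delta x > 0 on Omega minus the origin.  Induction
   on the iterations yields 0 <= Vlo i <= V <= Vhi i, hence V >= 0 and V 0 = 0.
   Since D is bounded below by a positive constant on compact sets avoiding the
   origin, Lyapunov's direct method applies although G itself need only be
   continuous at the origin. *)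

Section LyapunovDirectMethod.
Variables (R : realType) (n : nat).
Implicit Types (Omega : set 'rV[R]_n) (G : 'rV[R]_n -> 'rV[R]_n).

Lemma continuous_at0_norm (W : normedModType R) (g : 'rV[R]_n -> W) :
  {for 0, continuous g} -> g 0 = 0 ->
  forall e, 0 < e -> exists2 d, 0 < d & forall x, `|x| < d -> `|g x| < e.
Proof.
move=> gc g0 e e0; have /cvgrPdist_lt/(_ e e0)/nbhs_normP[d d0 dP] := gc.
exists d => // x xd; rewrite -normrN -sub0r -{1}g0; apply: dP.
by rewrite /= sub0r normrN.
Qed.

(** Removing the open ball of radius [r] from [Omega] leaves a compact set without the origin, on
    which [g] attains a positive minimum. If nothing is left, any constant serves. *)
Lemma compact_positive_lower_bound Omega (g : 'rV[R]_n -> R) (r : R) :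
  compact Omega -> continuous g -> 0 < r ->
  (forall x, Omega x -> x != 0 -> 0 < g x) ->
  exists2 a, 0 < a & forall x, Omega x -> r <= `|x| -> a <= g x.
Proof.
move=> cO gc r0 gpos; pose K := Omega `&` [set x | r <= `|x|].
have cK : compact K.
  apply: compact_closedI => //.
  rewrite -[X in closed X]/((fun x : 'rV[R]_n => `|x|) @^-1` [set y | r <= y]).
  by apply: preimage_closed (@closed_ge _ r) => x _; exact: norm_continuous.
have [K0|/set0P/negP/negPn/eqP KE] := pselect (K !=set0); last first.
  exists 1 => // x Ox rx; suff : K x by rewrite KE.
  by split.
have [z] := compact_EVT_min K0 cK (continuous_subspaceT gc).
rewrite inE => -[Oz rz] zmin; exists (g z) => [|x Ox rx].
  by apply: gpos => //; rewrite -normr_gt0; exact: lt_le_trans rz.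
by apply: zmin; rewrite inE; split.
Qed.

Lemma lyapunov_direct_method Omega G (V D : 'rV[R]_n -> R) :
  compact Omega -> interior Omega 0 ->
  G 0 = 0 -> {for 0, continuous G} ->
  continuous V -> V 0 = 0 -> (forall x, 0 <= V x) ->
  continuous D -> (forall x, Omega x -> x != 0 -> 0 < D x) ->
  (forall x, Omega x -> V (G x) <= V x - D x) ->
  asymptotically_stable G.
Proof.
move=> cO /nbhs_normP[r0 /= r00 r0O] G0 Gc Vc V0 V_ge0 Dc D_gt0 V_decr.
have inO x : `|x| < r0 -> Omega x.
  by move=> xr; apply: r0O; rewrite /= sub0r normrN.
(* Positivity of [V] comes from the decrease itself: [0 <= V (G x) <= V x - D x]. *)
have V_gt0 x : Omega x -> x != 0 -> 0 < V x.
  move=> Ox x0; have := V_decr x Ox; have := D_gt0 x Ox x0.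
  by have := V_ge0 (G x); lra.
have V_noninc x : Omega x -> V (G x) <= V x.
  move=> Ox; have [->|x0] := eqVneq x 0; first by rewrite G0.
  by have := V_decr x Ox; have := D_gt0 x Ox x0; lra.
(* Capping the radius by [r0] keeps the orbit inside [Omega], the only place where [V] is known to
   decrease; [Omega] itself need not be invariant. *)
have stable e : 0 < e -> exists2 d, 0 < d &
    forall x, `|x| < d -> forall k, `|iter k G x| < Num.min e r0.
  move=> e0; set e' := Num.min e r0.
  have e'0 : 0 < e' by rewrite lt_min e0.
  have [r r_gt0 rP] := continuous_at0_norm _ G Gc G0 e' e'0.
  have r1_gt0 : 0 < Num.min r e' by rewrite lt_min r_gt0.
  have [a a0 aP] := compact_positive_lower_bound Omega V _ cO Vc r1_gt0 V_gt0.
  have [d d0 dP] := continuous_at0_norm _ (V : _ -> R^o) (Vc 0) V0 a a0.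
  exists (Num.min d (Num.min r e')) => [|x]; first by rewrite lt_min d0.
  rewrite lt_min => /andP[xd xr] k.
  (* A jump from the inner ball stays inside the radius e', and the sublevel
     set V < a has no point between the two radii. *)
  suff [] : `|iter k G x| < Num.min r e' /\ V (iter k G x) < a.
    by rewrite lt_min => /andP[].
  elim: k => [|k [IHr IHV]] /=.
    by split=> //; have := dP x xd; exact/le_lt_trans/ler_norm.
  move: (IHr); rewrite lt_min => /andP[kr ke].
  have Ok : Omega (iter k G x).
    by apply/inO/(lt_le_trans ke); rewrite ge_min lexx orbT.
  have VG : V (G (iter k G x)) < a := le_lt_trans (V_noninc _ Ok) IHV.
  split=> //; rewrite ltNge; apply/negP => rG.
  suff OG : Omega (G (iter k G x)) by have := aP _ OG rG; rewrite leNgt VG.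
  by apply/inO/(lt_le_trans (rP _ kr)); rewrite ge_min lexx orbT.
split.
  move=> e e0; have [d d0 dP] := stable e e0; exists d => // x xd k.
  by have := dP x xd k; rewrite lt_min => /andP[].
have [d0 d00 d0P] := stable r0 r00; exists d0 => // x xd.
apply/cvgrPdist_lt => e e0; have [d d_gt0 dP] := stable e e0.
have Ok k : Omega (iter k G x).
  by apply: inO; have := d0P x xd k; rewrite minxx.
(* By [stable], one visit to the [d]-ball confines the rest of the orbit to the [e]-ball. An orbit
   that never visits it loses at least a fixed [a] of [V] per step, so [V] would turn negative after
   more than [V x / a] steps. *)
have [k kd] : exists k, `|iter k G x| < d.
  apply: contrapT => /forallNP far.
  have {}far k : d <= `|iter k G x| by rewrite leNgt; apply/negP/far.
  have [a a0 aP] := compact_positive_lower_bound Omega D _ cO Dc d_gt0 D_gt0.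
  have Vk k : V (iter k G x) <= V x - k%:R * a.
    elim: k => [|k IH] /=; first by rewrite mul0r subr0.
    have := V_decr _ (Ok k); have := aP _ (Ok k) (far k).
    by rewrite -natr1 mulrDl mul1r; lra.
  have := le_trans (V_ge0 _) (Vk (Num.truncn (V x / a)).+1).
  have := truncnS_gt (V x / a).
  by rewrite ltr_pdivrMr//; lra.
near=> j; rewrite sub0r normrN.
have /subnK <- : (k <= j)%N by near: j; exact: nbhs_infty_ge.
by rewrite iterD; have := dP _ kd (j - k)%N; rewrite lt_min => /andP[].
Unshelve. all: by end_near. Qed.

End LyapunovDirectMethod.

Section Bellman.
Variables (R : realType) (n : nat).
Implicit Types (W : 'rV[R]_n -> bool -> R) (F : bool -> 'rV[R]_n -> 'rV[R]_n)
  (V : 'rV[R]_n -> R).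

Lemma bellman_le W F V x v : bellman W F V x <= W x v + V (F v x).
Proof. by rewrite /bellman; case: v; rewrite ge_min lexx ?orbT. Qed.

Lemma le_bellman W F V x a :
  (forall v, a <= W x v + V (F v x)) -> a <= bellman W F V x.
Proof. by move=> aP; rewrite le_min !aP. Qed.

Lemma continuous_bellman W F V :
  (forall v, continuous (W ^~ v)) -> (forall v, continuous (F v)) ->
  continuous V -> continuous (bellman W F V).
Proof.
move=> Wc Fc Vc x.
have c v : {for x, continuous (fun y => W y v + V (F v y) : R^o)}.
  exact: (@cvgD _ R^o _ _ _ _ _ _ _ (Wc v x) (continuous_comp (Fc v x) (Vc _))).
exact: continuous_min (c false) (c true).
Qed.

Lemma exact_value_iteration_ge0 W F (V : nat -> 'rV[R]_n -> R) :
  (forall x v, 0 <= W x v) -> exact_value_iteration W F V ->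
  forall j x, 0 <= V j x.
Proof.
move=> W_ge0 [V0 VS]; elim=> [|j IH] x; first by have /andP[] := V0 x.
by rewrite VS; apply: le_bellman => v; exact: addr_ge0.
Qed.

Lemma exact_value_iteration_at0_le0 W F (V : nat -> 'rV[R]_n -> R) :
  W 0 false = 0 -> F false 0 = 0 -> exact_value_iteration W F V ->
  forall j, V j 0 <= 0.
Proof.
move=> W0 F0 [V0 VS]; elim=> [|j IH]; first
  by have /andP[_] := V0 0; rewrite W0.
by rewrite VS (le_trans (bellman_le _ _ _ _ false))// W0 F0 add0r.
Qed.

Lemma closed_loop_bellman_le W F V pol x :
  greedy_policy W F V pol ->
  V (closed_loop F pol x) <= bellman W F V x - W x (pol x).
Proof. by move=> polP; rewrite lerBrDl; exact: le_bellman (polP x). Qed.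

(** However [pol] switches near the origin, both modes send a common neighbourhood of 0 close to
    0. *)
Lemma continuous_closed_loop_at0 F (pol : 'rV[R]_n -> bool) :
  (forall v, continuous (F v)) -> (forall v, F v 0 = 0) ->
  {for 0, continuous (closed_loop F pol)}.
Proof.
move=> Fc F0.
suff : closed_loop F pol y @[y --> (0 : 'rV[R]_n)] --> (0 : 'rV[R]_n).
  by rewrite -[X in _ --> X -> _](F0 (pol 0)).
apply/(@cvgrPdist_lt _ _ _ (nbhs (0 : 'rV[R]_n)) (nbhs_filter _)) => e e0.
have near0 v : \forall y \near (0 : 'rV[R]_n), `|0 - F v y| < e.
  have [d d0 dP] := continuous_at0_norm _ _ _ (F v) (Fc v 0) (F0 v) e e0.
  apply/nbhs_normP; exists d => // y yd; rewrite sub0r normrN; apply: dP.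
  by rewrite -normrN -sub0r.
near=> y; rewrite /closed_loop; case: (pol y); near: y; exact: near0.
Unshelve. all: by end_near. Qed.

(** The shift [c * U x false] does not depend on [v], so it passes through the minimum over modes
    and absorbs an error of at most that size at every iteration. *)
Lemma approximate_value_iteration_bounds (U : 'rV[R]_n -> bool -> R) F (c : R)
    (Vlo Vhi Vhat eps : nat -> 'rV[R]_n -> R) :
  exact_value_iteration (fun x v => U x v - c * U x false) F Vlo ->
  exact_value_iteration (fun x v => U x v + c * U x false) F Vhi ->
  (forall x, Vlo 0%N x <= Vhat 0%N x <= Vhi 0%N x) ->
  (forall j x, Vhat j.+1 x = bellman U F (Vhat j) x + eps j x) ->
  (forall j x, `|eps j x| <= c * U x false) ->
  forall j x, Vlo j x <= Vhat j x <= Vhi j x.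
Proof.
move=> [_ loS] [_ hiS] V0 VS epsP; elim=> [|j IH] x; first exact: V0.
have := epsP j x; rewrite ler_norml VS loS hiS => /andP[e1 e2].
set W1 := fun _ _ => _ - _; set W2 := fun _ _ => U _ _ + _.
have lo : bellman W1 F (Vlo j) x + c * U x false <= bellman U F (Vhat j) x.
  apply: le_bellman => v; have := bellman_le W1 F (Vlo j) x v.
  by rewrite {2}/W1; have /andP[] := IH (F v x); lra.
have hi : bellman U F (Vhat j) x <= bellman W2 F (Vhi j) x - c * U x false.
  rewrite lerBrDr; apply: le_bellman => v.
  have := bellman_le U F (Vhat j) x v.
  by rewrite /W2; have /andP[] := IH (F v x); lra.
by apply/andP; split; lra.
Qed.

End Bellman.

Lemma continuous_mode (R : realType) (n m : nat)
    (f : 'rV[R]_n -> 'rV[R]_m -> 'rV[R]_n) (h : 'rV[R]_n -> 'rV[R]_m) v :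
  continuous (fun p : 'rV[R]_n * 'rV[R]_m => f p.1 p.2) -> continuous h ->
  continuous (mode f h v).
Proof.
move=> fc hc x; pose u y := if v then h y else 0.
have uc : {for x, continuous u}.
  by rewrite /u {u}; case: v; [exact: hc|exact: cst_continuous].
exact: (cvg_comp _ _ (cvg_pair cvg_id uc) (fc (x, u x))).
Qed.

Theorem theorem2 (R : realType) (n m : nat)
    (f : 'rV[R]_n -> 'rV[R]_m -> 'rV[R]_n) (h : 'rV[R]_n -> 'rV[R]_m)
    (U : 'rV[R]_n -> bool -> R) (Omega : set 'rV[R]_n) (c : R)
    (Vlo Vhi Vhat eps : nat -> 'rV[R]_n -> R)
    (i : nat) (delta : 'rV[R]_n -> R) (vhat : 'rV[R]_n -> bool)
    (f_continuous : continuous (fun p : 'rV[R]_n * 'rV[R]_m => f p.1 p.2))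
    (f_origin : f 0 0 = 0)
    (U_cost : running_cost U)
    (U_weight : nonneg_scheduling_weight U)
    (Omega_compact : compact Omega)
    (Omega_origin : interior Omega 0)
    (h_admissible : admissible Omega f U h)
    (c_range : 0 <= c < 1)
    (Vlo_iteration :
      exact_value_iteration (fun x v => U x v - c * U x false) (mode f h) Vlo)
    (Vhi_iteration :
      exact_value_iteration (fun x v => U x v + c * U x false) (mode f h) Vhi)
    (Vhat_initial : forall x, Vlo 0%N x <= Vhat 0%N x <= Vhi 0%N x)
    (Vhat_iteration :
      forall j x, Vhat j.+1 x = bellman U (mode f h) (Vhat j) x + eps j x)
    (Vhat_continuous : forall j, continuous (Vhat j))
    (eps_bound : forall j x, `|eps j x| <= c * U x false)
    (delta_psd : positive_semidefinite delta)
    (termination : forall x, Omega x -> `|Vhat i x - Vhat i.+1 x| <= delta x)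
    (invariant_zero_cost : forall v : bool,
      invariant_part (mode f h v) [set x | U x v = 0] = [set 0])
    (vhat_argmin : greedy_policy U (mode f h) (Vhat i) vhat)
    (delta_small :
      forall x, (Omega `\` [set 0]) x -> delta x < (1 - c) * U x false) :
  asymptotically_stable (closed_loop (mode f h) vhat).
Proof.
have [hc h0 _ _ _] := h_admissible; have /andP[c_ge0 c_lt1] := c_range.
have Uc v : continuous (U ^~ v) by case: (U_cost v).
have U_ge0 x v : 0 <= U x v by case: (U_cost v) => _ [_]; exact.
have U0 v : U 0 v = 0 by case: (U_cost v) => _ [].
have Fc v : continuous (mode f h v) by exact: continuous_mode.
have F0 v : mode f h v 0 = 0 by rewrite /mode h0 if_same.
set V := Vhat i.
have V_bounds x : Vlo i x <= V x <= Vhi i x.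
  exact: (approximate_value_iteration_bounds _ _ U (mode f h) c _ _ _ eps).
have V_ge0 x : 0 <= V x.
  have /andP[loV _] := V_bounds x; apply: le_trans loV.
  apply: (exact_value_iteration_ge0 _ _ _ _ _ _ Vlo_iteration) => y v.
  (* The lowered cost is still non-negative, because [c < 1] and transmitting never costs less than
     not transmitting. *)
  rewrite subr_ge0; apply: (@le_trans _ _ (U y false)).
    by rewrite ler_piMl// ltW.
  by case: v.
have V0 : V 0 = 0.
  apply/le_anti; rewrite V_ge0 andbT; have /andP[_] := V_bounds 0.
  move/le_trans; apply.
  (* At the origin, mode [false] stays put at zero cost, so the upper iteration cannot rise above 0
     there. *)
  apply: (exact_value_iteration_at0_le0 _ _ _ _ _ _ _ Vhi_iteration) => //.
  by rewrite !U0 mulr0 addr0.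
pose D x : R := V x - bellman U (mode f h) V x + U x false.
apply: (@lyapunov_direct_method R n Omega _ V D) => //.
- by rewrite /closed_loop F0.
- exact: continuous_closed_loop_at0.
- exact: Vhat_continuous.
- have Bc := continuous_bellman _ _ U _ _ Uc Fc (Vhat_continuous i).
  move=> x; apply: (@cvgD _ R^o _ _ _ _ _ _ _ _ (Uc false x)).
  exact: (@cvgB _ R^o _ _ _ _ _ _ _ (Vhat_continuous i x) (Bc x)).
- move=> x Ox /eqP x0; have := delta_small x (conj Ox x0).
  have := termination x Ox; rewrite Vhat_iteration ler_norml => /andP[t1 _].
  have := eps_bound i x; rewrite ler_norml => /andP[e1 _].
  by rewrite /D /V; lra.
- move=> x _; have := closed_loop_bellman_le _ _ _ _ _ _ x vhat_argmin.
  (* The greedy choice subtracts [U x (vhat x)], which may jump with the policy; replacing it by the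
     smaller [U x false] leaves exactly [V x - D x], with [D] continuous. *)
  have : U x false <= U x (vhat x) by case: (vhat x).
  by rewrite /D -/V; lra.
Qed.
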